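(* Let $R_1,R_2$ be commutative rings with $1$, let $M$ be an $(R_1,R_2)$-bimodule, and let $R=\begin{pmatrix}R_1&M\\0&R_2\end{pmatrix}$. Let $$\ell:=\min\{n\in\mathbb N\mid na=0\text{ for all }a\in R_1\cup R_2\},\qquad m:=\min\{n\in\mathbb N\mid na=0\text{ for all }a\in M\},$$ where $\ell:=0$ (respectively $m:=0$) if the corresponding set is empty. Then all polynomials from $P_n(\mathbb Z)\cap\operatorname{Id}(R,\mathbb Z)$, $n\in\mathbb N$, are consequences of the left hand sides of the following polynomial identities in $R$: $$[x,y][z,t]\equiv0,\qquad \ell x\equiv0,\qquad m[x,y]\equiv0,$$ where $[x,y]:=xy-yx$. Moreover, as abelian groups, $$\frac{P_n(\mathbb Z)}{P_n(\mathbb Z)\cap\operatorname{Id}(R,\mathbb Z)}\cong\mathbb Z_\ell\oplus(\mathbb Z_m)^{(n-2)2^{n-1}+1}.$$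
   Context: $\mathbb N=\{1,2,\dots\}$; $\mathbb Z_k=\mathbb Z/k\mathbb Z$ and $\mathbb Z_0:=\mathbb Z$. Bimodules are unital. $\mathbb Z\langle X\rangle$ is the free associative ring without $1$ on $X=\{x_1,x_2,\dots\}$ ($x,y,z,t$ denote distinct variables). $\operatorname{Id}(R,\mathbb Z)\subseteq\mathbb Z\langle X\rangle$ is the set of $f$ with $f(a_1,\dots,a_n)=0$ for all $a_i\in R$. $P_n(\mathbb Z)$ is the additive subgroup of $\mathbb Z\langle X\rangle$ generated by $x_{\sigma(1)}\cdots x_{\sigma(n)}$, $\sigma\in S_n$. A T-ideal of $\mathbb Z\langle X\rangle$ is an ideal invariant under all ring endomorphisms of $\mathbb Z\langle X\rangle$; a polynomial is a consequence of given polynomials if it lies in the T-ideal they generate. *)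

(* Defs.v *)
From HB Require Import structures.
From mathcomp Require Import all_boot all_order all_fingroup all_algebra finmap.
From mathcomp Require Import boolp.
From mathcomp.multinomials Require Import monalg.

Set Implicit Arguments.
Unset Strict Implicit.
Unset Printing Implicit Defensive.

Import GRing.Theory.
Local Open Scope ring_scope.

(* Rings are of type pzRingType, so the zero ring (1 = 0) is allowed. *)

HB.mixin Record Lmodule_isBimodule (R1 R2 : pzRingType) M
    of GRing.Lmodule R1 M := {
  ract : M -> R2 -> M;
  ractA : forall v b c, ract (ract v b) c = ract v (b * c);
  ract1 : forall v, ract v 1 = v;
  ractDl : forall b, {morph ract^~ b : u v / u + v};
  ractDr : forall v, {morph ract v : b c / b + c};
  scale_ractA : forall a v b, a *: ract v b = ract (a *: v) b
}.

#[short(type="bimodType")]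
HB.structure Definition Bimodule (R1 R2 : pzRingType) :=
  {M of GRing.Lmodule R1 M & Lmodule_isBimodule R1 R2 M}.

Notation "v *:r b" := (ract v b) (at level 40, left associativity) : ring_scope.

Section UpperTriangular.
Variables (R1 R2 : pzRingType) (M : bimodType R1 R2).

Record uptri : Type := UpTri { ut11 : R1; ut12 : M; ut22 : R2 }.

Definition uptri_prod (A : uptri) : R1 * M * R2 := (ut11 A, ut12 A, ut22 A).
Definition prod_uptri (p : R1 * M * R2) : uptri := UpTri p.1.1 p.1.2 p.2.
Fact uptri_prodK : cancel uptri_prod prod_uptri. Proof. by case. Qed.
HB.instance Definition _ := Choice.copy uptri (can_type uptri_prodK).

Definition uptri0 := UpTri 0 0 0.
Definition uptri1 := UpTri 1 0 1.
Definition uptri_opp A := UpTri (- ut11 A) (- ut12 A) (- ut22 A).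
Definition uptri_add A B :=
  UpTri (ut11 A + ut11 B) (ut12 A + ut12 B) (ut22 A + ut22 B).
Definition uptri_mul A B :=
  UpTri (ut11 A * ut11 B) (ut11 A *: ut12 B + ut12 A *:r ut22 B)
        (ut22 A * ut22 B).

Fact uptri_addA : associative uptri_add.
Proof. by move=> A B C; rewrite /uptri_add /= !addrA. Qed.
Fact uptri_addC : commutative uptri_add.
Proof. by move=> A B; congr UpTri; rewrite /= addrC. Qed.
Fact uptri_add0 : left_id uptri0 uptri_add.
Proof. by case=> a v b; rewrite /uptri_add /= !add0r. Qed.
Fact uptri_addN : left_inverse uptri0 uptri_opp uptri_add.
Proof. by move=> A; rewrite /uptri_add /= !addNr. Qed.
HB.instance Definition _ :=
  GRing.isZmodule.Build uptri uptri_addA uptri_addC uptri_add0 uptri_addN.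

Fact ract0l b : (0 : M) *:r b = 0.
Proof. by apply: (addrI ((0 : M) *:r b)); rewrite -ractDl !addr0. Qed.
Fact ract0r (v : M) : v *:r 0 = 0.
Proof. by apply: (addrI (v *:r 0)); rewrite -ractDr !addr0. Qed.

Fact uptri_mulA : associative uptri_mul.
Proof.
move=> A B C; rewrite /uptri_mul /= !mulrA; congr UpTri.
by rewrite scalerDr scalerA ractDl ractA scale_ractA addrA.
Qed.
Fact uptri_mul1l : left_id uptri1 uptri_mul.
Proof. by case=> a v b; rewrite /uptri_mul /= !mul1r scale1r ract0l addr0. Qed.
Fact uptri_mul1r : right_id uptri1 uptri_mul.
Proof. by case=> a v b; rewrite /uptri_mul /= !mulr1 scaler0 ract1 add0r. Qed.
Fact uptri_mulDl : left_distributive uptri_mul +%R.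
Proof.
move=> A B C; congr UpTri; rewrite /= ?mulrDl //.
by rewrite scalerDl ractDl addrACA.
Qed.
Fact uptri_mulDr : right_distributive uptri_mul +%R.
Proof.
move=> A B C; congr UpTri; rewrite /= ?mulrDr //.
by rewrite scalerDr ractDr addrACA.
Qed.
HB.instance Definition _ := GRing.Zmodule_isPzRing.Build uptri
  uptri_mulA uptri_mul1l uptri_mul1r uptri_mulDl uptri_mulDr.

End UpperTriangular.

(* The free associative ring without 1 is the ideal of polynomials with zero
   constant term in the free associative ring with 1, i.e. in the monoid ring
   of the free monoid.  The variable x_i is indexed by i - 1 : nat. *)
Notation freering1 := {malg int[{fmonom nat}]}.

Definition constfree : {pred freering1} :=
  [pred f : freering1 | f@_(@mone {fmonom nat}) == 0].

Fact constfree_zmod_closed : zmod_closed constfree.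
Proof.
split=> [|f g]; rewrite !inE ?mcoeff0 // => /eqP f0 /eqP g0.
by rewrite mcoeffB f0 g0 subr0.
Qed.
HB.instance Definition _ :=
  GRing.isZmodClosed.Build freering1 constfree constfree_zmod_closed.

Record freering : predArgType :=
  Freering { freering_val : freering1; _ : freering_val \in constfree }.
HB.instance Definition _ := [isSub for freering_val].
HB.instance Definition _ := [Choice of freering by <:].
HB.instance Definition _ := [SubChoice_isSubZmodule of freering by <:].

Fact constfreeM (f g : freering) : val f * val g \in constfree.
Proof.
have: val f \in constfree by exact: valP.
rewrite !inE => /eqP f0; rewrite malgME raddf_sum /= big1 // => u _.
rewrite raddf_sum /= big1 // => v _; rewrite mcoeffU.
case: eqP => [/unitm[-> _]|_ //]; by rewrite f0 mul0r.
Qed.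
Definition frmul (f g : freering) : freering := Freering (constfreeM f g).

Declare Scope freering_scope.
Delimit Scope freering_scope with F.
Infix "*" := frmul : freering_scope.

Fact constfreeX i : << fmu i >> \in constfree.
Proof. by rewrite !inE mcoeffU -val_eqE /= fm1 fmU. Qed.
Definition var (i : nat) : freering := Freering (constfreeX i).

Definition frcomm (f g : freering) : freering := (f * g)%F - (g * f)%F.

Definition eval (R : pzRingType) (a : nat -> R) (f : freering) : R :=
  \sum_(w <- msupp (val f)) (\prod_(i <- (w : seq nat)) a i) *~ (val f)@_w.

Definition Id (R : pzRingType) : {pred freering} :=
  [pred f | `[< forall a : nat -> R, eval a f = 0 >]].

Definition is_ideal (I : {pred freering}) : Prop :=
  zmod_closed I /\
  (forall f g, f \in I -> (f * g)%F \in I /\ (g * f)%F \in I).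

(* Ring endomorphisms of a ring without 1: there is no condition on 1. *)
Definition is_Tideal (I : {pred freering}) : Prop :=
  is_ideal I /\
  (forall phi : {additive freering -> freering},
     {morph phi : f g / (f * g)%F} -> forall f, f \in I -> phi f \in I).

Definition Tideal_gen (S : {pred freering}) : {pred freering} :=
  [pred f | `[< forall I : {pred freering},
                  is_Tideal I -> {subset S <= I} -> f \in I >]].

Definition consequence (S : seq freering) (f : freering) : Prop :=
  f \in Tideal_gen (mem S).

Definition subgroup_gen (V : zmodType) (S : V -> Prop) : {pred V} :=
  [pred v | `[< forall H : {pred V}, zmod_closed H ->
                  (forall s, S s -> s \in H) -> v \in H >]].

Fact subgroup_gen_zmod_closed (V : zmodType) (S : V -> Prop) :
  zmod_closed (subgroup_gen S).
Proof.
split=> [|u v /asboolP Su /asboolP Sv]; apply/asboolP=> H Hz HS.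
  by case: Hz.
by case: (Hz) => _; apply; [exact: Su | exact: Sv].
Qed.

(* The product is computed in the free ring with 1. *)
Definition multilinear_monomial n (f : freering) : Prop :=
  exists s : 'S_n, val f = \prod_(i < n) val (var (s i)).

Definition Pn n : {pred freering} := subgroup_gen (multilinear_monomial n).

HB.instance Definition _ n :=
  GRing.isZmodClosed.Build freering (Pn n) (subgroup_gen_zmod_closed _).

Record Pgroup n : predArgType :=
  PGroup { Pgroup_val : freering; _ : Pgroup_val \in Pn n }.
HB.instance Definition _ n := [isSub for @Pgroup_val n].
HB.instance Definition _ n := [Choice of Pgroup n by <:].
HB.instance Definition _ n := [SubChoice_isSubZmodule of Pgroup n by <:].

Lemma evalEw (R : pzRingType) (a : nat -> R) (d : {fset {fmonom nat}}) f :
  (msupp (val f) `<=` d)%fset ->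
  eval a f = \sum_(w <- d) (\prod_(i <- (w : seq nat)) a i) *~ (val f)@_w.
Proof.
move=> le; rewrite [LHS](big_fset_incl _ le) //= => w _ /mcoeff_outdom ->.
by rewrite mulr0z.
Qed.

Lemma evalB (R : pzRingType) (a : nat -> R) f g :
  eval a (f - g) = eval a f - eval a g.
Proof.
pose d := (msupp (val f) `|` msupp (val g) `|` msupp (val (f - g)))%fset.
have [le_f le_g] : (msupp (val f) `<=` d)%fset /\ (msupp (val g) `<=` d)%fset.
  by split; apply/fsubsetP => w Hw; rewrite !inE Hw ?orbT.
rewrite (evalEw a (fsubsetUr _ _ : msupp (val (f - g)) `<=` d)%fset).
rewrite (evalEw a le_f) (evalEw a le_g) -sumrB.
by apply: eq_bigr => w _; rewrite -mulrzBr -mcoeffB.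
Qed.

Definition PId (R : pzRingType) n : {pred Pgroup n} := [pred f | val f \in Id R].
Arguments PId : clear implicits.

Fact PId_zmod_closed (R : pzRingType) n : zmod_closed (PId R n).
Proof.
split=> [|f g /asboolP f0 /asboolP g0]; apply/asboolP=> a.
  by rewrite raddf0 -(subrr (0 : freering)) evalB subrr.
by rewrite raddfB evalB f0 g0 subr0.
Qed.
HB.instance Definition _ (R : pzRingType) n :=
  GRing.isZmodClosed.Build (Pgroup n) (PId R n) (PId_zmod_closed R n).

(* P_n / (P_n \cap Id(R)) *)
Definition Pquot (R : pzRingType) n : zmodType :=
  Quotient.quot (PId R n : zmodClosed (Pgroup n)).

(* Z / kZ for every k, including k = 0 (Z itself) and k = 1 (trivial), unlike
   'Z_k *)
Definition Zmod (k : nat) : zmodType :=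
  Quotient.quot ((dvdz k%:Z : {pred int}) : zmodClosed int).

Definition isomorphic (A B : zmodType) : Prop :=
  exists phi : {additive A -> B}, bijective phi.

(* The least positive n with Q n, or 0 if there is none. *)
Definition min_pos (Q : nat -> Prop) : nat :=
  match pselect (exists n, (0 < n)%N && `[< Q n >]) with
  | left exQ => ex_minn exQ
  | right _ => 0%N
  end.

(* At n = 1 the factor n - 2 is -1, hence the computation in int. *)
Definition mrank (n : nat) : nat := absz ((n%:Z - 2) * 2 ^+ n.-1 + 1).

(* Main.v *)
Require Import Defs.
From HB Require Import structures.
From mathcomp Require Import all_boot all_order all_fingroup all_algebra.
From mathcomp Require Import finmap boolp zify.
From mathcomp.multinomials Require Import monalg.

Set Implicit Arguments.
Unset Strict Implicit.
Unset Printing Implicit Defensive.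

Import GRing.Theory.
Local Open Scope ring_scope.

(** Read a permutation of the [n] letters as a maximal chain in the Boolean
    lattice of subsets of [{0, .., n-1}]: its prefixes give the vertices, and
    the step that adds the letter [j] to the set [U] is the edge [(U, j)].  The
    corner entry of a product of [n] upper triangular matrices is a sum over the
    factor [j] that supplies its corner; the letters before [j] contribute their
    [R1]-entries and those after [j] their [R2]-entries, and both commute.  So
    evaluation on [R] sees of a multilinear [f] only the sum of its coefficients
    ([augmentation]) and, for every edge, the sum of the coefficients of the
    words whose chain uses it ([crossing]).  Matrices with entries 0, 1 and one
    element of [M] isolate each of these numbers, so that an identity has its
    augmentation divisible by [l] and its crossing numbers divisible by [m].

    Conversely, write [p] and [q] for two words in the same letters, and [p']
    and [q'] for two words in the remaining letters.  Then [p - q] and [p' - q']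
    lie in the commutator ideal, and a product of two elements of this ideal
    vanishes modulo [[x,y][z,t]].  Hence [p p'] is congruent to
    [q p' + (p - q) q'], which says that the part of a chain above a vertex may
    be straightened independently of the part below it.  Straightening a word
    one vertex after the other, from the bottom up, gives ([monom_expand], [eval_mod])

      word = sorted word + sum over its edges (U, j) of swap U j,

    where [swap U j] is the difference of the two words that reach [U + j] by
    the sorted list of [U] followed by [j] or by the sorted list of [U + j], and
    then list the remaining letters in order.  It is zero when [j] exceeds all
    elements of [U], so only the other edges ([backward]) matter.  A multilinear
    [f] is therefore congruent to its augmentation times the sorted word plus
    the sum of its backward crossing numbers times swaps.  As [l x] and [m [x,y]]
    are consequences as well, the divisibilities above put [f] into the T-ideal.
    The same computation with the zero ideal of [R] shows that they suffice for
    [f] to be an identity.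

    Finally the swap of a backward edge crosses that edge once and no other
    backward edge ([crossing_swap]), because sorted lists never cross a backward
    edge.  So the augmentation and the backward crossing numbers take arbitrary
    integer values on multilinear polynomials, and the quotient is [Z_l] plus one copy
    of [Z_m] for each backward edge.  There are [n 2^(n-1) - (2^n - 1)] of them
    ([card_backward]). *)

(** * The commutator ideal *)

Section CommutatorProducts.
Variable A : pzRingType.
Implicit Types (J K : A -> Prop) (x y z t b c : A).

Definition comm x y := x * y - y * x.

Lemma commC x y : comm x y = - comm y x.
Proof. by rewrite /comm opprB. Qed.

(** Scalars are central, so commutators ignore constant terms: the free ring with
    unit has the same commutators as the free ring without unit. *)
Lemma comm_addz x y (k : int) : comm (x + k%:~R) y = comm x y.
Proof. by rewrite /comm mulrDl mulrDr mulrzl mulrzr opprD addrACA subrr addr0. Qed.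

Definition two_sided K := [/\ K 0, forall x y, K x -> K y -> K (x - y),
  forall c x, K x -> K (c * x) & forall c x, K x -> K (x * c)].

Lemma two_sidedD K : two_sided K -> forall x y, K x -> K y -> K (x + y).
Proof.
by case=> K0 KB _ _ x y Kx Ky; rewrite -[y]opprK -(sub0r y); apply/KB/KB.
Qed.

Lemma two_sidedMz K : two_sided K -> forall x k, K x -> K (x *~ k).
Proof. by case=> _ _ _ KM x k Kx; rewrite -mulrzr; apply: KM. Qed.

Lemma two_sided_sum K : two_sided K ->
  forall (I : Type) (r : seq I) (P : pred I) (F : I -> A),
  (forall i, P i -> K (F i)) -> K (\sum_(i <- r | P i) F i).
Proof.
move=> idK I r P F KF; apply: big_ind => //; last exact: two_sidedD.
by case: idK.
Qed.

Inductive comm_ideal : A -> Prop :=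
| comm_ideal_comm x y : comm_ideal (comm x y)
| comm_ideal0 : comm_ideal 0
| comm_idealB b c : comm_ideal b -> comm_ideal c -> comm_ideal (b - c)
| comm_idealMl c b : comm_ideal b -> comm_ideal (c * b)
| comm_idealMr c b : comm_ideal b -> comm_ideal (b * c).

Lemma comm_ideal_two_sided : two_sided comm_ideal.
Proof.
split; [exact: comm_ideal0 | exact: comm_idealB | exact: comm_idealMl |].
exact: comm_idealMr.
Qed.

(** The only point beyond generators is a factor [d] between two commutators.  It is
    absorbed by the Leibniz rule [[x, y d] = [x, y] d + y [x, d]]. *)
Lemma comm_idealM J : two_sided J ->
    (forall x y z t, J (comm x y * comm z t)) ->
  forall b c, comm_ideal b -> comm_ideal c -> J (b * c).
Proof.
move=> [J0 JB JMl JMr] Jcc.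
have mid b z t : comm_ideal b -> forall d, J (b * d * comm z t).
  elim=> {b} [x y d|d|b c _ IHb _ IHc d|c b _ IH d|c b _ IH d].
  - have -> : comm x y * d = comm x (y * d) - y * comm x d.
      by rewrite /comm mulrBl mulrBr !mulrA opprB addrA subrK.
    rewrite mulrBl; apply: JB; first exact: Jcc.
    by rewrite -mulrA; apply: JMl.
  - by rewrite !mul0r.
  - by rewrite !mulrBl; apply: JB.
  - by rewrite -!mulrA; apply: JMl; rewrite mulrA.
  - by rewrite -(mulrA b).
move=> b c Cb Cc.
elim: Cc b Cb => {c} [x y||c d _ IHc _ IHd|d c _ IH|d c _ IH] b Cb.
- by rewrite -[b]mulr1; apply: mid.
- by rewrite mulr0.
- by rewrite mulrBr; apply: JB; [apply: IHc | apply: IHd].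
- by rewrite mulrA; apply: IH; apply: comm_idealMr.
- by rewrite mulrA; apply: JMr; apply: IH.
Qed.

Lemma comm_idealMn J m : two_sided J -> (forall x y, J (comm x y *+ m)) ->
  forall b, comm_ideal b -> J (b *+ m).
Proof.
move=> [J0 JB JMl JMr] Jm b.
elim=> {b} [//||b c _ IHb _ IHc|c b _ IH|c b _ IH]; first by rewrite mul0rn.
- by rewrite mulrnBl; apply: JB.
- by rewrite -mulrnAr; apply: JMl.
- by rewrite -mulrnAl; apply: JMr.
Qed.

(** Moving a letter to the front of a word costs one commutator. *)
Lemma comm_ideal_perm (I : eqType) (a : I -> A) p q : perm_eq p q ->
  comm_ideal (\prod_(i <- p) a i - \prod_(i <- q) a i).
Proof.
have [C0 CB CMl CMr] := comm_ideal_two_sided.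
elim: p q => [|x p IH] q.
  by rewrite perm_sym => /perm_nilP ->; rewrite subrr.
move=> pq; have xq: x \in q by rewrite -(perm_mem pq) mem_head.
case/splitPr: xq pq => q1 q2 pq.
have /IH pq' : perm_eq p (q1 ++ q2).
  by rewrite -(perm_cons x) (perm_trans pq) // perm_catC /= perm_cons perm_catC.
rewrite !big_cat !big_cons /=; set X := a x; set P := \prod_(_ <- p) _.
rewrite big_cat /= -/P in pq'; set Q1 := \prod_(_ <- q1) _ in pq' *.
set Q2 := \prod_(_ <- q2) _ in pq' *.
have -> : X * P - Q1 * (X * Q2) = X * (P - Q1 * Q2) + comm X Q1 * Q2.
  by rewrite /comm mulrBr mulrBl !mulrA addrA subrK.
apply: (two_sidedD comm_ideal_two_sided); first exact: CMl.
by apply/CMr/comm_ideal_comm.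
Qed.

End CommutatorProducts.

(** * Words as chains of subsets *)

Section BooleanLattice.
Variable n : nat.
Implicit Types (U : {set 'I_n}) (j : 'I_n) (w : seq 'I_n).

(** The vertex at which the chain of [w] adds [j]; so [w] uses the edge [(U, j)] if
    and only if [before w j = U]. *)
Definition before w j : {set 'I_n} := [set i in take (index j w) w].

Lemma beforeE s1 j s2 : j \notin s1 -> before (s1 ++ j :: s2) j = [set i in s1].
Proof.
move=> js1; rewrite /before index_cat (negPf js1) /= eqxx addn0.
by rewrite take_size_cat.
Qed.

Lemma before_cat p q j :
  before (p ++ q) j = if j \in p then before p j else [set i in p] :|: before q j.
Proof.
rewrite /before index_cat take_cat.
case: (boolP (j \in p)) => jp; first by rewrite index_mem jp.
rewrite ltnNge leq_addr /= addKn.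
by apply/setP=> i; rewrite !inE mem_cat.
Qed.

Lemma enum_setU1_perm U j : j \notin U -> perm_eq (enum (j |: U)) (j :: enum U).
Proof.
move=> jU; apply: uniq_perm; rewrite /= ?enum_uniq ?mem_enum ?jU //.
by move=> i; rewrite !inE !mem_enum !inE.
Qed.

Lemma ltn_ord_trans : transitive (fun i j : 'I_n => (i < j)%N).
Proof. by move=> j i k; apply: ltn_trans. Qed.

Lemma sorted_enum_set U : sorted (fun i j : 'I_n => (i < j)%N) (enum U).
Proof.
rewrite {1}/enum_mem; apply: sorted_filter; first exact: ltn_ord_trans.
have := iota_ltn_sorted 0 n; rewrite -val_enum_ord sorted_map.
by rewrite enumT.
Qed.

(** The edges on which listing [U] in order and then [j] is not increasing. *)
Definition backward (e : {set 'I_n} * 'I_n) :=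
  (e.2 \notin e.1) && [exists i in e.1, (e.2 < i)%N].

Lemma enum_setU1_max U j :
  j \notin U -> ~~ backward (U, j) -> enum (j |: U) = rcons (enum U) j.
Proof.
rewrite /backward /= => jU; rewrite jU /= => /exists_inPn Uj.
apply: (irr_sorted_eq (leT := fun i j : 'I_n => (i < j)%N)).
- exact: ltn_ord_trans.
- by move=> i; apply: ltnn.
- exact: sorted_enum_set.
- rewrite (sorted_pairwise ltn_ord_trans) pairwise_rcons.
  rewrite -(sorted_pairwise ltn_ord_trans) sorted_enum_set andbT.
  apply/allP=> i; rewrite mem_enum => iU; rewrite ltn_neqAle leqNgt Uj // andbT.
  by apply: contraNneq jU => /val_inj <-.
- by move=> i; rewrite mem_rcons -(perm_mem (enum_setU1_perm jU)).
Qed.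

Lemma before_enum_lt U r j i :
  j \in U -> i \in before (enum U ++ r) j -> (i < j)%N.
Proof.
move=> jU; rewrite before_cat mem_enum jU.
have := sorted_enum_set U; rewrite (sorted_pairwise ltn_ord_trans).
have jeU : j \in enum U by rewrite mem_enum.
have := enum_uniq U; case/splitPr: jeU => s1 s2 us /=.
move: us; rewrite cat_uniq /= => /and3P[_ /norP[js1 _] _].
rewrite beforeE // pairwise_cat inE => /and3P[/allrelP lt _ _] is1.
by apply: lt; rewrite ?mem_head.
Qed.

(** An increasing list reaches each letter after smaller letters only, while the
    lower vertex of a backward edge contains a larger one. *)
Lemma before_enum_backward U r e : backward e -> e.2 \in U ->
  (before (enum U ++ r) e.2 == e.1) = false.
Proof.
case/andP=> _ /exists_inP[i iS ji] eU; apply: contraTF ji => /eqP eS.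
rewrite -eS in iS.
by rewrite -leqNgt ltnW // (before_enum_lt eU iS).
Qed.

End BooleanLattice.

(** * Straightening words modulo products of commutators *)

Section Telescope.
Variables (A : pzRingType) (J : A -> Prop) (n : nat) (a : 'I_n -> A).
Hypotheses (idJ : two_sided J)
  (Jcc : forall x y z t, J (comm x y * comm z t)).
Implicit Types (U : {set 'I_n}) (j : 'I_n) (w : seq 'I_n).

Definition monom w : A := \prod_(i <- w) a i.

Definition swap U j : A :=
  monom (enum U ++ j :: enum (~: (j |: U))) -
  monom (enum (j |: U) ++ enum (~: (j |: U))).

Lemma swap_comm_ideal U j : j \notin U -> comm_ideal (swap U j).
Proof.
move=> jU; apply: comm_ideal_perm.
by rewrite -cat_rcons perm_cat2r perm_rcons perm_sym enum_setU1_perm.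
Qed.

(** The lower part of the word is already sorted and [w] is what remains.  Each step
    moves the first letter [j] of [w] into the sorted part; this costs [swap U j]
    because the rest of [w] may be replaced by its sorted version, the error being
    a product of two elements of the commutator ideal. *)
Lemma monom_telescope w U : uniq w -> w =i ~: U ->
  J (monom (enum U ++ w) - monom (enum 'I_n)
     - \sum_(j <- w) swap (U :|: before w j) j).
Proof.
case: (idJ) => J0 JB JMl JMr.
elim: w U => [|j w IH] U /=.
  move=> _ U_T; rewrite big_nil subr0 cats0.
  have -> : enum U = enum 'I_n.
    by apply: eq_enum => i; have := U_T i; rewrite !inE; case: (i \in U).
  by rewrite subrr.
case/andP=> jw uw w_U.
have jU : j \notin U by have := w_U j; rewrite !inE eqxx => /esym.
have w_jU : w =i ~: (j |: U).
  move=> i; have := w_U i; rewrite !inE.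
  by case: eqP => //= -> _; rewrite (negPf jw).
have := IH _ uw w_jU; set s := \sum_(_ <- w) _ => Jw.
rewrite big_cons.
have -> : \sum_(i <- w) swap (U :|: before (j :: w) i) i = s.
  apply: eq_big_seq => i iw; congr swap; apply/setP => k; rewrite !inE /=.
  by case: (j =P i) iw jw => [<- -> //|_ _ _]; rewrite inE orbCA orbA.
rewrite /before /= eqxx /= (_ : _ :|: _ = U); last first.
  by apply/setP=> k; rewrite !inE orbF.
set e := monom (enum 'I_n) in Jw *.
(* The last product lies in J: both factors compare words in the same letters. *)
have -> : monom (enum U ++ j :: w) - e - (swap U j + s) =
   (monom (enum (j |: U) ++ w) - e - s) +
   (monom (rcons (enum U) j) - monom (enum (j |: U))) *
   (monom w - monom (enum (~: (j |: U)))).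
  have aux (p y d : A) : p - e - (d + s) = (y - e - s) + (p - y - d).
    by rewrite [RHS]addrC [RHS]addrAC !addrA subrK opprD addrA addrAC.
  rewrite /swap -!cat_rcons /monom !big_cat /= mulrBr !mulrBl; exact: aux.
apply: two_sidedD => //; apply: comm_idealM => //; apply: comm_ideal_perm.
  by rewrite perm_rcons perm_sym enum_setU1_perm.
by apply: uniq_perm; rewrite ?enum_uniq // => i; rewrite mem_enum w_jU.
Qed.

Lemma swap_eq0 U j : j \notin U -> ~~ backward (U, j) -> swap U j = 0.
Proof.
by move=> jU max_j; rewrite /swap enum_setU1_max // cat_rcons subrr.
Qed.

(** The sum over the letters of [w] becomes a sum over all backward edges, so that
    it can be extended linearly to sums of words. *)
Lemma monom_expand w : perm_eq w (enum 'I_n) ->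
  J (monom w - monom (enum 'I_n)
     - \sum_(e | backward e) swap e.1 e.2 *+ (before w e.2 == e.1)).
Proof.
move=> w_perm; have uw : uniq w by rewrite (perm_uniq w_perm) enum_uniq.
have w_T : w =i ~: set0 by move=> i; rewrite (perm_mem w_perm) !inE mem_enum.
have := monom_telescope uw w_T; rewrite enum_set0 cat0s.
congr (J (_ - _)); rewrite (perm_big _ w_perm) big_enum /=.
have -> : \sum_(e | backward e) swap e.1 e.2 *+ (before w e.2 == e.1) =
    \sum_j \sum_U if backward (U, j) then swap U j *+ (before w j == U) else 0.
  by rewrite exchange_big pair_bigA big_mkcond; apply: eq_bigr => -[].
apply: eq_bigr => j _; rewrite (bigD1 (before w j)) //= big1 => [|U].
  rewrite set0U eqxx addr0; case: ifPn => // /swap_eq0 -> //.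
  have : j \in w by rewrite (perm_mem w_perm) mem_enum.
  move=> jw; case/splitPr: jw uw => p q; rewrite cat_uniq /= negb_or.
  by case/and4P=> _ /andP[jp _] _ _; rewrite beforeE // inE.
by rewrite eq_sym => /negPf ->; rewrite if_same.
Qed.

End Telescope.

(** * Linear functions on the free ring *)

Section WordSums.
Variables (V : zmodType) (chi : seq nat -> V).
Implicit Types g h : freering1.

(** The linear extension of [chi] from words to polynomials.  Evaluations and the
    coefficient sums that determine them are all of this form. *)
Definition wsum g : V := \sum_(w <- msupp g) chi w *~ g@_w.

Lemma wsumEw (d : {fset {fmonom nat}}) g : (msupp g `<=` d)%fset ->
  wsum g = \sum_(w <- d) chi w *~ g@_w.
Proof.
move=> le; rewrite [LHS](big_fset_incl _ le) //= => w _ /mcoeff_outdom ->.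
by rewrite mulr0z.
Qed.

Fact wsum_is_zmod_morphism : zmod_morphism wsum.
Proof.
move=> f g; pose d := (msupp f `|` msupp g)%fset.
rewrite (wsumEw (msuppB_le f g)) (wsumEw (fsubsetUl _ _ : msupp f `<=` d)%fset).
rewrite (wsumEw (fsubsetUr _ _ : msupp g `<=` d)%fset) -sumrB.
by apply: eq_bigr => w _; rewrite -mulrzBr -mcoeffB.
Qed.
HB.instance Definition _ :=
  GRing.isZmodMorphism.Build freering1 V wsum wsum_is_zmod_morphism.

Lemma wsumU c (w : {fmonom nat}) : wsum << c *g w >> = chi w *~ c.
Proof. by rewrite (wsumEw msuppU_le) big_seq_fset1 mcoeffUU. Qed.

End WordSums.

Lemma word_prodE (w : seq nat) :
  \prod_(i <- w) << fmu i >> = << FMonom w >> :> freering1.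
Proof.
elim: w => [|i w IH]; first by rewrite big_nil -fmoneE.
by rewrite big_cons IH malgM_def fgmulUU mulr1 [mmul _ _]fmmulE fmuE.
Qed.

Lemma wsum_word (V : zmodType) (chi : seq nat -> V) w :
  wsum chi (\prod_(i <- w) << fmu i >>) = chi w.
Proof. by rewrite word_prodE wsumU. Qed.

Section WordSumsRing.
Variables (R : pzRingType) (a : nat -> R).

Lemma wsumM (g h : freering1) : let ev := wsum (fun w => \prod_(i <- w) a i) in
  ev (g * h) = ev g * ev h.
Proof.
move=> ev; rewrite malgME {}/ev raddf_sum /= big_distrl; apply: eq_bigr => u _.
rewrite raddf_sum /= big_distrr; apply: eq_bigr => v _.
rewrite /= wsumU [mmul u v]fmmulE /= big_cat /=.
by rewrite mulrzAr mulrzAl -mulrzA.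
Qed.

Lemma eval_wsum f : eval a f = wsum (fun w => \prod_(i <- w) a i) (val f).
Proof. by []. Qed.

Lemma evalM f g : eval a (f * g)%F = eval a f * eval a g.
Proof. by rewrite eval_wsum wsumM. Qed.

Lemma eval_var i : eval a (var i) = a i.
Proof. by rewrite eval_wsum wsumU fmuE big_seq1. Qed.

Lemma eval_comm f g : eval a (frcomm f g) = comm (eval a f) (eval a g).
Proof. by rewrite /frcomm evalB !evalM. Qed.

Lemma evalMn f k : eval a (f *+ k) = eval a f *+ k.
Proof. by rewrite !eval_wsum !raddfMn. Qed.

End WordSumsRing.

(** Evaluation at the variables themselves: statements on evaluations in arbitrary
    rings apply to the polynomials of the free ring. *)
Lemma eval_self (f : freering) :
  eval (fun i => << fmu i >> : freering1) f = val f.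
Proof.
rewrite eval_wsum [RHS]monalgE; apply: eq_bigr => w _.
by rewrite word_prodE fmK -(raddfMz (mkmalgU w)) /= intz.
Qed.

(** Reduces additive statements on multilinear polynomials to words over ['I_n]. *)
Lemma Pn_ind n (K : freering -> Prop) :
    K 0 -> (forall f g, K f -> K g -> K (f - g)) ->
    (forall f (w : seq 'I_n), perm_eq w (enum 'I_n) ->
       val f = \prod_(i <- map val w) << fmu i >> -> K f) ->
  forall f, f \in Pn n -> K f.
Proof.
move=> K0 KB Kw f /asboolP Pf; apply/asboolP.
apply: (Pf [pred g | `[< K g >]]) => [|g [s gs]].
  split=> [|g h /asboolP Kg /asboolP Kh]; apply/asboolP => //; exact: KB.
apply/asboolP/(Kw _ (map s (enum 'I_n))).
  apply: uniq_perm; rewrite ?(map_inj_uniq perm_inj) ?enum_uniq // => i.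
  by rewrite mem_enum -[i](permKV s) map_f ?mem_enum.
by rewrite gs !big_map [index_enum _]unlock.
Qed.

(** For [n = 0] this fails: the empty word is not in the ring without unit. *)
Lemma word_Pn n (w : seq 'I_n) : (0 < n)%N -> perm_eq w (enum 'I_n) ->
  exists2 f : freering,
    f \in Pn n & val f = \prod_(i <- map val w) << fmu i >>.
Proof.
move=> n_gt0 wP.
have sz : size w = n by rewrite (perm_size wP) size_enum_ord.
have uw : uniq w by rewrite (perm_uniq wP) enum_uniq.
have cf : \prod_(i <- map val w) << fmu i >> \in constfree.
  rewrite word_prodE inE mcoeffU1 -val_eqE /= fm1.
  by case: (w) sz n_gt0 => // <-.
exists (Freering cf) => //; apply/asboolP => H _; apply.
(* The default value [i] of [nth] is never reached, as [size w = n]. *)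
have inj_w : injective (fun i : 'I_n => nth i w i).
  move=> i j; rewrite (set_nth_default i) ?sz // => /eqP.
  by rewrite nth_uniq ?sz // => /eqP/val_inj.
exists (perm inj_w) => /=; rewrite big_map.
case: n => // n in w wP sz uw cf n_gt0 inj_w *.
rewrite (big_nth ord0) sz big_mkord; apply: eq_bigr => i _.
by rewrite permE (set_nth_default ord0) ?sz.
Qed.

(** * Exponents, quotients and the number of backward edges *)

Section Exponent.
Variables (V : zmodType) (Q : nat -> Prop).
Hypothesis Q_kills : forall n, Q n <-> forall v : V, v *+ n = 0.

Lemma min_pos_kills (v : V) : v *+ min_pos Q = 0.
Proof.
rewrite /min_pos; case: pselect => [exQ|_]; last by rewrite mulr0n.
by case: ex_minnP => k /andP[_ /asboolP /Q_kills].
Qed.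

(** The integers that kill [V] form a subgroup, and [min_pos Q] is its nonnegative
    generator: a nonzero remainder would be a smaller positive member. *)
Lemma dvdz_min_pos (k : int) : (forall v : V, v *~ k = 0) -> (min_pos Q %| k)%Z.
Proof.
move=> kills; have {}kills : Q `|k|%N.
  apply/Q_kills => v; case: k kills => p kills; first exact: kills.
  by apply/eqP; rewrite -oppr_eq0; apply/eqP/kills.
suff : (min_pos Q %| `|k|)%N by [].
rewrite /min_pos.
case: pselect => [exQ|nQ]; last first.
  rewrite dvd0n; apply/eqP; case: (posnP `|k|) => // k_gt0.
  case: nQ; exists `|k|%N; apply/andP; split=> //.
  exact/asboolP.
case: ex_minnP => p /andP[p_gt0 /asboolP Qp] p_min.
apply: contraT; rewrite /dvdn -lt0n => r_gt0.
have : (p <= `|k| %% p)%N; last by rewrite leqNgt ltn_pmod.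
apply: p_min; rewrite r_gt0 /=; apply/asboolP/Q_kills => v.
have /Q_kills /(_ v) := kills; rewrite {1}(divn_eq `|k| p) mulrnDr mulnC mulrnA.
by have /Q_kills -> := Qp; rewrite mul0rn add0r.
Qed.

End Exponent.

Section FirstIsomorphism.
Variables (V W : zmodType) (K : zmodClosed V) (g : {additive V -> W}).
Hypotheses (g_surj : forall w, exists v, g v = w)
  (g_ker : forall v, (v \in K) = (g v == 0)).

Definition quot_lift (q : Quotient.quot K) : W := g (generic_quotient.repr q).

Lemma quot_lift_pi v : quot_lift (\pi_(Quotient.quot K) v)%qT = g v.
Proof.
apply/eqP; rewrite -subr_eq0 -raddfB -g_ker Quotient.idealrBE.
by rewrite generic_quotient.reprK.
Qed.

Fact quot_lift_is_zmod_morphism : zmod_morphism quot_lift.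
Proof.
move=> p q; rewrite -[p]generic_quotient.reprK -[q]generic_quotient.reprK.
by rewrite -raddfB !quot_lift_pi raddfB.
Qed.
HB.instance Definition _ := GRing.isZmodMorphism.Build (Quotient.quot K) W
  quot_lift quot_lift_is_zmod_morphism.

Lemma first_isomorphism : isomorphic (Quotient.quot K) W.
Proof.
exists quot_lift; pose h w := (\pi_(Quotient.quot K) (projT1 (cid (g_surj w))))%qT.
have hK : cancel h quot_lift by move=> w; rewrite quot_lift_pi; case: cid.
have inj : injective quot_lift.
  move=> p q; rewrite -[p]generic_quotient.reprK -[q]generic_quotient.reprK.
  rewrite !quot_lift_pi => /eqP; rewrite -subr_eq0 -raddfB -g_ker.
  by rewrite Quotient.idealrBE => /eqP.
by exists h => // q; apply: inj; rewrite hK.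
Qed.

End FirstIsomorphism.

Lemma Zmod_pi_eq0 k (z : int) :
  ((\pi_(Zmod k) z)%qT == 0) = (k %| z)%Z.
Proof. by rewrite -(raddf0 (\pi_(Zmod k))%qT) -Quotient.idealrBE subr0. Qed.

Section CountBackward.
Variable n : nat.

(** For fixed [j] the sets [U] avoid [j] but are not contained in [{0, .., j-1}]. *)
Lemma card_backward_fiber (j : 'I_n) :
  #|[set S : {set 'I_n} | backward (S, j)]| = (2 ^ n.-1 - 2 ^ j)%N.
Proof.
pose L := [set i : 'I_n | (i < j)%N].
have -> : [set S | backward (S, j)] = powerset [set~ j] :\: powerset L.
  apply/setP=> S; rewrite !inE subsetC sub1set inE /backward /= andbC.
  case: (boolP (j \in S)) => [|jS]; rewrite ?andbF // !andbT.
  apply/exists_inP/subsetPn => -[i iS ji]; exists i => //.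
    by rewrite inE -leqNgt ltnW.
  rewrite inE -leqNgt in ji; rewrite ltn_neqAle ji andbT.
  by apply: contraNneq jS => /val_inj ->.
rewrite cardsD (setIidPr _) ?powersetS; last first.
  by apply/subsetP=> i; rewrite !inE; apply: contraTneq => ->; rewrite ltnn.
rewrite !card_powerset cardsC1 card_ord; congr (_ - 2 ^ _)%N.
rewrite -sum1_card (eq_bigl (fun i : 'I_n => (i < j)%N)) => [|i]; last first.
  by rewrite inE.
by rewrite -(big_ord_widen n (fun=> 1%N) (ltnW (ltn_ord j))) sum1_card card_ord.
Qed.

(** [sum_j (2^(n-1) - 2^j) = n 2^(n-1) - (2^n - 1) = (n-2) 2^(n-1) + 1]. *)
Lemma card_backward : (0 < n)%N -> #|@backward n| = mrank n.
Proof.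
move=> n_gt0.
have -> : #|@backward n| = (\sum_(j < n) (2 ^ n.-1 - 2 ^ j))%N.
  rewrite -sum1_card big_mkcond -(pair_bigA _ (fun S j =>
    if (S, j) \in @backward n then 1%N else 0%N)) exchange_big /=.
  apply: eq_bigr => j _; rewrite -card_backward_fiber -big_mkcond sum1dep_card.
  by [].
rewrite sumnB; last first.
  by move=> j _; rewrite leq_pexp2l // -ltnS prednK // ltn_ord.
rewrite sum_nat_const card_ord; have := predn_exp 2 n; rewrite mul1n => <-.
case: n n_gt0 => // [[|k]] _; first by rewrite /mrank.
have q_gt0 : (0 < 2 ^ k.+1)%N by rewrite expn_gt0.
have -> : mrank k.+2 = (k * 2 ^ k.+1 + 1)%N.
  by rewrite /mrank -[k.+2]addn2 PoszD addrK -natrX natz -PoszM addn2.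
by rewrite (expnS 2 k.+1) /=; lia.
Qed.

End CountBackward.

(** * Augmentation and crossing numbers *)

Section Coordinates.
Variable n : nat.
Implicit Types (f g : freering) (U : {set 'I_n}) (j : 'I_n).
Implicit Types (e : {set 'I_n} * 'I_n) (w : seq 'I_n).

Definition augmentation f : int := wsum (fun=> 1) (val f).

(** The words of the free ring are sequences of naturals, so the vertex [before w j]
    is written here for such sequences; [crossing_word] gives the translation. *)
Definition crossing e f : int :=
  wsum (fun w : seq nat =>
    ([set i : 'I_n | val i \in take (index (val e.2) w) w] == e.1)%:R) (val f).

Fact augmentation_is_zmod_morphism : zmod_morphism augmentation.
Proof. by move=> f g; rewrite /augmentation !raddfB. Qed.
HB.instance Definition _ :=
  GRing.isZmodMorphism.Build freering int augmentation
    augmentation_is_zmod_morphism.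

Fact crossing_is_zmod_morphism e : zmod_morphism (crossing e).
Proof. by move=> f g; rewrite /crossing !raddfB. Qed.
HB.instance Definition _ e :=
  GRing.isZmodMorphism.Build freering int (crossing e)
    (crossing_is_zmod_morphism e).

Lemma augmentation_word f w :
  val f = \prod_(i <- map val w) << fmu i >> -> augmentation f = 1.
Proof. by rewrite /augmentation => ->; rewrite wsum_word. Qed.

Lemma crossing_word e f w : val f = \prod_(i <- map val w) << fmu i >> ->
  crossing e f = (before w e.2 == e.1)%:R.
Proof.
rewrite /crossing => ->; rewrite wsum_word (index_map val_inj) -map_take.
congr (_ == _)%:R; apply/setP => i; rewrite !inE.
exact: (mem_map val_inj).
Qed.

Lemma eval_word (R : pzRingType) (a : nat -> R) f w :
  val f = \prod_(i <- map val w) << fmu i >> ->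
  eval a f = monom (fun i : 'I_n => a (val i)) w.
Proof. by rewrite eval_wsum => ->; rewrite wsum_word big_map. Qed.

Section ModuloIdeal.
Variables (A : pzRingType) (J : A -> Prop) (a : nat -> A).
Hypotheses (idJ : two_sided J)
  (Jcc : forall x y z t, J (comm x y * comm z t)).
Local Notation a' := (fun i : 'I_n => a (val i)).

Lemma eval_mod f : f \in Pn n ->
  J (eval a f - monom a' (enum 'I_n) *~ augmentation f
     - \sum_(e | backward e) swap a' e.1 e.2 *~ crossing e f).
Proof.
have [J0 JB _ _] := idJ.
apply: (Pn_ind (K := fun f => J (eval a f - _ *~ augmentation f
    - \sum_(e | backward e) swap a' e.1 e.2 *~ crossing e f)))
  => [|g h Jg Jh|g w wP gw].
- rewrite raddf0 mulr0z big1 => [|e _]; last by rewrite raddf0 mulr0z.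
  by rewrite -(subrr (0 : freering)) evalB !subrr.
- have := JB _ _ Jg Jh; congr J; rewrite evalB (raddfB augmentation) mulrzBr.
  under [in RHS]eq_bigr => e _ do rewrite raddfB mulrzBr.
  rewrite sumrB; set x := eval _ _; set y := eval _ _.
  set x1 := _ *~ _; set y1 := _ *~ _; set x2 := \sum_(_ | _) _.
  set y2 := \sum_(_ | _) _.
  by rewrite !opprD addrACA (addrACA x).
- have := @monom_expand _ _ _ a' idJ Jcc w wP; congr J.
  rewrite (eval_word _ gw) (augmentation_word gw) mulr1z; congr (_ - _).
  by apply: eq_bigr => e _; rewrite (crossing_word _ gw); case: eqP.
Qed.

Variables (l m : nat).
Hypotheses (Jm : forall x y, J (comm x y *+ m))
  (Jl : J (monom a' (enum 'I_n) *+ l)).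

(** Stated for an arbitrary ideal because it is used twice: with the zero ideal of
    the matrix ring, and with any T-ideal that contains the three polynomials. *)
Lemma eval_in_ideal f : f \in Pn n -> (l %| augmentation f)%Z ->
  (forall e, backward e -> (m %| crossing e f)%Z) -> J (eval a f).
Proof.
move=> Pf l_f m_f; have := eval_mod Pf.
set s := \sum_(_ | _) _; set t := _ *~ _ => Jst.
have Js : J s.
  apply: two_sided_sum => // -[U j] be; have /andP[/= jU _] := be.
  have /dvdzP[q ->] := m_f _ be; rewrite mulrC mulrzA; apply: two_sidedMz => //.
  by apply: comm_idealMn => //; apply: swap_comm_ideal.
have Jt : J t.
  rewrite /t; have /dvdzP[q ->] := l_f; rewrite mulrC mulrzA.
  exact: two_sidedMz.
have -> : eval a f = eval a f - t - s + (s + t) by rewrite addrA subrK subrK.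
by apply: two_sidedD => //; apply: two_sidedD.
Qed.

End ModuloIdeal.

(** The two words agree from [U + j] on, so their crossings above that vertex cancel.
    Below it they are increasing, hence cross no backward edge, apart from the
    last step [(U, j)] of the first word. *)
Lemma crossing_swap e U j f g : backward e -> backward (U, j) ->
  val f = \prod_(i <- map val (enum U ++ j :: enum (~: (j |: U)))) << fmu i >> ->
  val g = \prod_(i <- map val (enum (j |: U) ++ enum (~: (j |: U)))) << fmu i >> ->
  crossing e (f - g) = ((U, j) == e)%:R.
Proof.
case: e => S k bS /andP[/= jU _] fw gw; rewrite raddfB /=.
rewrite (crossing_word _ fw) (crossing_word _ gw) xpair_eqE.
case: (boolP (k \in j |: U)) => kjU; last first.
  move: (kjU); rewrite in_setU1 negb_or => /andP[kj kU].
  rewrite -cat_rcons !before_cat mem_rcons inE !mem_enum (negPf kU) (negPf kj).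
  rewrite (negPf kjU) [j == k]eq_sym (negPf kj) andbF /=.
  suff -> : [set i in rcons (enum U) j] = [set i in enum (j |: U)].
    by rewrite subrr.
  by apply/setP=> i; rewrite !inE mem_rcons inE !mem_enum !inE.
rewrite (before_enum_backward _ bS kjU) subr0.
move: kjU; rewrite in_setU1; case: eqP => [-> _|kj /= kU].
  rewrite beforeE ?mem_enum // eqxx andbT; congr (_ == _)%:R.
  by apply/setP=> i; rewrite inE mem_enum.
by rewrite (before_enum_backward _ bS kU) andbC; case: eqP kj => // ->.
Qed.

(** The swaps of the backward edges are dual to the crossing numbers and have
    augmentation 0, so any multiple of a word can be corrected by them. *)
Lemma coordinates_surj (t : int) (c : {set 'I_n} * 'I_n -> int) : (0 < n)%N ->
  exists2 f, f \in Pn n &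
    augmentation f = t /\ forall e, backward e -> crossing e f = c e.
Proof.
move=> n_gt0.
(* Zero serves off the backward edges, so that one can choose for every edge. *)
have swapP e : exists2 f, f \in Pn n & augmentation f = 0 /\
   forall e', backward e -> backward e' -> crossing e' f = (e == e')%:R.
  case: e => U j; case: (boolP (backward (U, j))) => [bU|_]; last first.
    by exists 0; rewrite ?rpred0 // raddf0.
  have /andP[/= jU _] := bU.
  have jU_perm : perm_eq (enum (j |: U) ++ enum (~: (j |: U))) (enum 'I_n).
    apply: uniq_perm; rewrite ?enum_uniq // ?cat_uniq ?enum_uniq ?andbT /=.
      by apply/hasPn => i; rewrite !mem_enum inE.
    by move=> i; rewrite mem_cat !mem_enum [in X in _ || X]inE orbN.
  have Uj_perm : perm_eq (enum U ++ j :: enum (~: (j |: U))) (enum 'I_n).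
    rewrite -cat_rcons (perm_trans _ jU_perm) // perm_cat2r perm_rcons perm_sym.
    exact: enum_setU1_perm.
  have [f Pf fw] := word_Pn n_gt0 Uj_perm.
  have [g Pg gw] := word_Pn n_gt0 jU_perm.
  exists (f - g); first exact: rpredB.
  split=> [|e' _ be']; last exact: crossing_swap.
  by rewrite raddfB /= (augmentation_word fw) (augmentation_word gw) subrr.
have [f0 Pf0 f0w] := word_Pn n_gt0 (perm_refl (enum 'I_n)).
pose sw e := s2val (cid2 (swapP e)).
have sw_P e : sw e \in Pn n by rewrite /sw; case: cid2.
have sw_t e : augmentation (sw e) = 0 by rewrite /sw; case: cid2 => ? ? [].
have sw_c e e' : backward e -> backward e' -> crossing e' (sw e) = (e == e')%:R.
  by rewrite /sw; case: cid2 => f Pf [_ cf] /=; apply: cf.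
pose g := \sum_(e | backward e) sw e *~ (c e - crossing e f0 *~ t).
exists (f0 *~ t + g).
  apply: rpredD; first exact: rpredMz.
  by apply: rpred_sum => e _; apply: rpredMz.
split=> [|e be]; rewrite raddfD raddfMz raddf_sum /=.
  rewrite (augmentation_word f0w) intz big1 ?addr0 // => e _.
  by rewrite raddfMz /= sw_t mul0rz.
rewrite (bigD1 e) //= raddfMz /= sw_c // eqxx intz big1 => [|e' /andP[be' ee']].
  by rewrite addr0 mulrzz addrC subrK.
by rewrite raddfMz /= sw_c // (negPf ee') mul0rz.
Qed.

End Coordinates.

(** * T-ideals inside the free ring with unit *)

Section Tideals.
Variable I : {pred freering}.
Hypothesis TI : is_Tideal I.

Definition lies_in_free1 (g : freering1) : Prop := exists2 f, f \in I & val f = g.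

Lemma constfree_decomp (g : freering1) :
  exists (f : freering) (k : int), g = val f + k%:~R.
Proof.
have cf : g - (g@_(@mone {fmonom nat}))%:~R \in constfree.
  rewrite inE mcoeffB (raddfMz (mcoeff _)) /= mcoeff1 eqxx mulr1n intz subrr.
  by [].
by exists (Freering cf), g@_(@mone {fmonom nat}); rewrite /= subrK.
Qed.

(** Multiplying by a constant is an integer multiple, so an ideal of the free ring
    without unit is also an ideal of the free ring with unit. *)
Lemma lies_in_free1_two_sided : two_sided lies_in_free1.
Proof.
have [[[I0 IB] IM] _] := TI.
have two : lies_in_free1 0 /\
    forall x y, lies_in_free1 x -> lies_in_free1 y -> lies_in_free1 (x - y).
  split=> [|_ _ [f If <-] [g Ig <-]]; first by exists 0.
  by exists (f - g); rewrite ?raddfB //; apply: IB.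
have zI f k : f \in I -> f *~ k \in I.
  pose H := GRing.isZmodClosed.Build freering I (conj I0 IB).
  pose I' : zmodClosed freering := HB.pack I H.
  exact: (@rpredMz _ I').
have DI f g : f \in I -> g \in I -> f + g \in I.
  by move=> If Ig; rewrite -[g]opprK -(sub0r g); apply/IB => //; apply: IB.
split; [by case: two | by case: two | |] => c _ [f If <-];
  have [d [k ->]] := constfree_decomp c; have [Ifd Idf] := IM f d If.
- exists ((d * f)%F + f *~ k); first by apply: DI; last exact: zI.
  by rewrite mulrDl raddfD raddfMz /= mulrzl.
- exists ((f * d)%F + f *~ k); first by apply: DI; last exact: zI.
  by rewrite mulrDr raddfD raddfMz /= mulrzr.
Qed.

Lemma comm_free1 (x y : freering1) :
  exists f g : freering, comm x y = val (frcomm f g).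
Proof.
have [f [k ->]] := constfree_decomp x; have [g [p ->]] := constfree_decomp y.
by exists f, g; rewrite comm_addz commC comm_addz -commC /frcomm raddfB.
Qed.

Section Substitution.
Variable a : nat -> freering.

(** A nonempty word remains without constant term because the constant term is a
    ring morphism; the empty word does not occur in [f]. *)
Fact subst_constfree f : eval (fun i => val (a i)) f \in constfree.
Proof.
apply: rpred_sum => w _; have := valP f; rewrite inE => /eqP f0.
have [->|w1] := eqVneq w (@mone {fmonom nat}); first by rewrite f0 mulr0z rpred0.
apply: rpredMz; case: w w1 => [[|i w]] /=; first by rewrite -val_eqE /= fm1.
move=> _; rewrite big_cons inE (rmorphM (mcoeff (@mone {fmonom nat}))) /=.
by have := valP (a i); rewrite inE => /eqP ->; rewrite mul0r.
Qed.

Definition subst f : freering := Freering (subst_constfree f).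

Fact subst_is_zmod_morphism : zmod_morphism subst.
Proof. by move=> f g; apply: val_inj; rewrite raddfB /= evalB. Qed.
HB.instance Definition _ :=
  GRing.isZmodMorphism.Build freering freering subst subst_is_zmod_morphism.

Lemma substM : {morph subst : f g / (f * g)%F}.
Proof. by move=> f g; apply: val_inj; rewrite /= evalM. Qed.

Lemma subst_var i : subst (var i) = a i.
Proof. by apply: val_inj; rewrite /= eval_var. Qed.

Lemma subst_comm f g : subst (frcomm f g) = frcomm (subst f) (subst g).
Proof. by rewrite /frcomm raddfB /= !substM. Qed.

Lemma subst_mem f : f \in I -> subst f \in I.
Proof. by case: TI => _; apply; apply: substM. Qed.

End Substitution.

End Tideals.

(** * Evaluation on triangular matrices *)

Section Units.
Variables (R1 R2 : comPzRingType) (M : bimodType R1 R2).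
Local Notation R := (uptri M).

HB.instance Definition _ :=
  GRing.isZmodMorphism.Build R R1 (@ut11 R1 R2 M) (fun _ _ => erefl).
HB.instance Definition _ :=
  GRing.isZmodMorphism.Build R M (@ut12 R1 R2 M) (fun _ _ => erefl).
HB.instance Definition _ :=
  GRing.isZmodMorphism.Build R R2 (@ut22 R1 R2 M) (fun _ _ => erefl).

Lemma uptri_eq (A B : R) :
  ut11 A = ut11 B -> ut12 A = ut12 B -> ut22 A = ut22 B -> A = B.
Proof. by case: A B => [a v b] [a' v' b'] /= -> -> ->. Qed.

Lemma uptri_comm (A B : R) : exists v, comm A B = UpTri 0 v 0.
Proof.
exists (ut12 (comm A B)); apply: uptri_eq => //=.
  by rewrite [ut11 B * _]mulrC subrr.
by rewrite [ut22 B * _]mulrC subrr.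
Qed.

Lemma uptri_commM (A B C D : R) : comm A B * comm C D = 0.
Proof.
have [v ->] := uptri_comm A B; have [w ->] := uptri_comm C D.
by apply: uptri_eq; rewrite /= ?mul0r // scale0r ract0r addr0.
Qed.

(** A scalar that kills [R1] kills the left [R1]-module [M]. *)
Lemma uptri_kill l (A : R) :
  (forall a : R1, a *+ l = 0) -> (forall b : R2, b *+ l = 0) -> A *+ l = 0.
Proof.
move=> l1 l2; apply: uptri_eq.
- by rewrite (raddfMn (@ut11 R1 R2 M)) l1.
- by rewrite (raddfMn (@ut12 R1 R2 M)) /= -[ut12 A]scale1r scalerMnl l1 scale0r.
- by rewrite (raddfMn (@ut22 R1 R2 M)) l2.
Qed.

Lemma uptri_comm_kill m (A B : R) :
  (forall v : M, v *+ m = 0) -> comm A B *+ m = 0.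
Proof.
move=> mM; have [v ->] := uptri_comm A B; apply: uptri_eq.
- by rewrite (raddfMn (@ut11 R1 R2 M)) mul0rn.
- by rewrite (raddfMn (@ut12 R1 R2 M)) mM.
- by rewrite (raddfMn (@ut22 R1 R2 M)) mul0rn.
Qed.

Lemma eval_one f : eval (fun=> 1 : R) f = 1 *~ augmentation f.
Proof.
rewrite eval_wsum /augmentation /wsum mulrz_sumr; apply: eq_bigr => w _.
by rewrite big1 // mulrzz mul1r.
Qed.

Variables (n : nat) (U : {set 'I_n}) (j : 'I_n) (v : M).

(** A product of these matrices has a nonzero corner only if exactly the letters of
    [U] stand before [j]: each letter of [U] is the idempotent of [R1], each letter
    outside [U + j] that of [R2], and [j] has the corner [v] only. *)
Definition unit_at (k : 'I_n) : R :=
  UpTri (k \in U)%:R (v *+ (k == j)) (k \notin j |: U)%:R.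

Lemma monom_unit_diag w : j \notin w ->
  monom unit_at w = UpTri (all (mem U) w)%:R 0 (all [predC (j |: U)] w)%:R.
Proof.
elim: w => [_|k w IH]; first by rewrite /monom big_nil.
rewrite inE negb_or eq_sym => /andP[kj jw].
rewrite /monom big_cons -/(monom _ _) IH // /unit_at (negPf kj).
by apply: uptri_eq; rewrite /= ?scaler0 ?ract0l ?addr0 // -natrM mulnb.
Qed.

Lemma monom_unit w : j \notin U -> perm_eq w (enum 'I_n) ->
  ut12 (monom unit_at w) = v *+ (before w j == U).
Proof.
move=> jU wP; have uw : uniq w by rewrite (perm_uniq wP) enum_uniq.
have w_T k : k \in w by rewrite (perm_mem wP) mem_enum.
have jw := w_T j; case/splitPr: jw uw w_T => p q; rewrite cat_uniq /=.
case/and4P=> _ /norP[jp pq] jq _ w_T.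
rewrite /monom big_cat big_cons /= -!/(monom _ _) !monom_unit_diag //.
rewrite beforeE // /= eqxx mulr1n (negPf jU) ract0l addr0 scaler0 add0r.
have -> : ([set k in p] == U) = all (mem U) p && all [predC (j |: U)] q.
  apply/eqP/andP => [<-|[/allP pU /allP qU]].
    split; apply/allP => k; rewrite !inE //= => kq.
    rewrite negb_or; apply/andP; split; first by apply: contraNneq jq => <-.
    by apply: contraNN pq => kp; apply/hasP; exists k.
  apply/setP => k; rewrite inE; apply/idP/idP => [/pU //|kU].
  have := w_T k; rewrite mem_cat inE; case: (k \in p) => //= /orP[/eqP kj|kq].
    by rewrite -kj kU in jU.
  by have := qU _ kq; rewrite !inE kU orbT.
case: (all _ p); last by rewrite scale0r.
case: (all _ q); last by rewrite ract0r scaler0.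
by rewrite scale1r ract1.
Qed.

(** Variables are indexed by all naturals; those outside ['I_n] do not occur in [f]. *)
Lemma eval_unit f : j \notin U -> f \in Pn n ->
  ut12 (eval (fun i => if insub i is Some k then unit_at k else 0) f)
  = v *~ crossing (U, j) f.
Proof.
move=> jU; set b := fun i : nat => _.
apply: (Pn_ind (K := fun f => ut12 (eval b f) = v *~ crossing (U, j) f)).
- by rewrite raddf0 mulr0z -(subrr (0 : freering)) evalB subrr.
- move=> g h Kg Kh; rewrite evalB (raddfB (@ut12 _ _ M)).
  by rewrite (raddfB (crossing _)) mulrzBr -Kg -Kh.
- move=> g w wP gw; rewrite (eval_word _ gw) (crossing_word _ gw) /=.
  have -> : monom (fun i : 'I_n => b (val i)) w = monom unit_at w.
    by apply: eq_bigr => k _; rewrite /b valK.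
  by rewrite monom_unit //; case: eqP.
Qed.

End Units.

(** * The identities of the triangular ring *)

Section Main.
Variables (R1 R2 : comPzRingType) (M : bimodType R1 R2).
Local Notation R := (uptri M).

Definition diag_exponent :=
  min_pos (fun n => (forall a : R1, a *+ n = 0) /\ (forall b : R2, b *+ n = 0)).
Definition corner_exponent := min_pos (fun n => forall v : M, v *+ n = 0).
Local Notation l := diag_exponent.
Local Notation m := corner_exponent.

Lemma pair_mulrn (p : R1 * R2) k : p *+ k = (p.1 *+ k, p.2 *+ k).
Proof. by rewrite -(raddfMn fst) -(raddfMn snd) -surjective_pairing. Qed.

(** Lets the lemmas on the exponent of a group serve for the two rings at once. *)
Lemma diag_kills k : ((forall a : R1, a *+ k = 0) /\ (forall b : R2, b *+ k = 0))
  <-> (forall p : (R1 * R2)%type, p *+ k = 0).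
Proof.
split=> [[k1 k2] p|kp]; first by rewrite pair_mulrn k1 k2.
by split=> c; [have := kp (c, 0) | have := kp (0, c)]; rewrite pair_mulrn => -[].
Qed.

Lemma diag_exponent1 (a : R1) : a *+ l = 0.
Proof.
by have := min_pos_kills diag_kills (a, 0); rewrite pair_mulrn => -[].
Qed.

Lemma diag_exponent2 (b : R2) : b *+ l = 0.
Proof.
by have := min_pos_kills diag_kills (0, b); rewrite pair_mulrn => -[].
Qed.

Lemma corner_exponentP (v : M) : v *+ m = 0.
Proof. exact: min_pos_kills. Qed.

Lemma mem_IdP f : reflect (forall a : nat -> R, eval a f = 0) (f \in Id R).
Proof. exact: asboolP. Qed.

Lemma augmentation_Id f : f \in Id R -> (l %| augmentation f)%Z.
Proof.
move=> /mem_IdP /(_ (fun=> 1)); rewrite eval_one => f0.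
apply: (dvdz_min_pos diag_kills) => -[a b].
have := congr1 (@ut11 R1 R2 M) f0; have := congr1 (@ut22 R1 R2 M) f0.
rewrite !raddfMz /= => b0 a0.
rewrite [LHS]surjective_pairing (raddfMz fst) (raddfMz snd) /=.
by rewrite -(mulrzr a) -(mulrzr b) a0 b0 !mulr0.
Qed.

Lemma crossing_Id n f e : f \in Pn n -> f \in Id R -> backward e ->
  (m %| @crossing n e f)%Z.
Proof.
case: e => U j Pf /mem_IdP f0 /andP[/= jU _].
apply: (@dvdz_min_pos M) => // v.
by rewrite -(eval_unit _ jU Pf) f0.
Qed.

Lemma Id_Pn n f : (0 < n)%N -> f \in Pn n ->
  (l %| augmentation f)%Z -> (forall e, backward e -> (m %| @crossing n e f)%Z) ->
  f \in Id R.
Proof.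
move=> n_gt0 Pf l_f m_f; apply/mem_IdP => a.
apply: (eval_in_ideal (J := fun x => x = 0) _ _ _ _ Pf l_f m_f).
- by split=> [|x y -> ->|c x ->|c x ->]; rewrite ?subrr ?mulr0 ?mul0r.
- exact: uptri_commM.
- by move=> x y; apply: uptri_comm_kill; apply: corner_exponentP.
- by apply: uptri_kill; [apply: diag_exponent1 | apply: diag_exponent2].
Qed.

Definition identities : seq freering :=
  [:: (frcomm (var 0) (var 1) * frcomm (var 2) (var 3))%F; var 0 *+ l;
      frcomm (var 0) (var 1) *+ m].

Lemma identities_Id : {subset identities <= Id R}.
Proof.
move=> f; rewrite !inE => /or3P[] /eqP-> ; apply/asboolP => a.
- by rewrite evalM !eval_comm uptri_commM.
- by rewrite evalMn uptri_kill //; [apply: diag_exponent1 | apply: diag_exponent2].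
- by rewrite evalMn eval_comm uptri_comm_kill //; apply: corner_exponentP.
Qed.

Lemma Pn_Id_consequence n f : (0 < n)%N -> f \in Pn n -> f \in Id R ->
  consequence identities f.
Proof.
move=> n_gt0 Pf If; apply/asboolP => I TI SI.
suff [g Ig /val_inj <-] : lies_in_free1 I (val f) by [].
rewrite -eval_self.
apply: (eval_in_ideal (lies_in_free1_two_sided TI) _ _ _ Pf (augmentation_Id If)).
- move=> x y z t; have [p [q ->]] := comm_free1 x y.
  have [r [s ->]] := comm_free1 z t.
  exists (frcomm p q * frcomm r s)%F => //.
  pose a i := nth 0 [:: p; q; r; s] i.
  have := subst_mem TI a (SI _ (mem_head _ _)).
  by rewrite substM !subst_comm !subst_var.
- move=> x y; have [p [q ->]] := comm_free1 x y.
  exists (frcomm p q *+ m); last by rewrite raddfMn.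
  pose a i := nth 0 [:: p; q] i.
  have xyI : frcomm (var 0) (var 1) *+ m \in I.
    by apply: SI; rewrite !inE eqxx !orbT.
  by have := subst_mem TI a xyI; rewrite raddfMn /= subst_comm !subst_var.
- have [g _ gw] := word_Pn n_gt0 (perm_refl (enum 'I_n)).
  rewrite big_map in gw; rewrite /monom -gw.
  exists (g *+ l); last by rewrite raddfMn.
  have xI : var 0 *+ l \in I by apply: SI; rewrite !inE eqxx !orbT.
  by have := subst_mem TI (fun=> g) xI; rewrite raddfMn /= subst_var.
- by move=> e; apply: crossing_Id.
Qed.

Section Quotient.
Variable n : nat.
Hypothesis n_gt0 : (0 < n)%N.
Local Notation W := (Zmod l * {ffun 'I_(mrank n) -> Zmod m})%type.

Definition edge (i : 'I_(mrank n)) : {set 'I_n} * 'I_n :=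
  enum_val (cast_ord (esym (card_backward n_gt0)) i).

Lemma edge_backward i : backward (edge i).
Proof. exact: (enum_valP (A := @backward n)). Qed.

Lemma edge_surj e : backward e -> exists i, edge i = e.
Proof.
move=> be; exists (cast_ord (card_backward n_gt0) (enum_rank_in be e)).
by rewrite /edge cast_ordK enum_rankK_in.
Qed.

Lemma edge_inj : injective edge.
Proof. by move=> i k /enum_val_inj /cast_ord_inj. Qed.

(** The isomorphism before passing to the quotient. *)
Definition coords (f : Pgroup n) : W :=
  (\pi_(Zmod l)%qT (augmentation (val f)),
   [ffun i => \pi_(Zmod m)%qT (crossing (edge i) (val f))]).

Fact coords_is_zmod_morphism : zmod_morphism coords.
Proof.
move=> f g; rewrite /coords (raddfB val) (raddfB augmentation) raddfB.
congr (_, _); apply/ffunP => i; rewrite !ffunE.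
by rewrite (raddfB (crossing _)) raddfB.
Qed.
HB.instance Definition _ :=
  GRing.isZmodMorphism.Build (Pgroup n) W coords coords_is_zmod_morphism.

Lemma coords_surj w : exists f, coords f = w.
Proof.
case: w => t c.
pose c' e := if [pick i | edge i == e] is Some i
  then generic_quotient.repr (c i) else 0.
have [f Pf [ft fc]] := coordinates_surj (generic_quotient.repr t) c' n_gt0.
exists (PGroup Pf); congr (_, _); first by rewrite /= ft generic_quotient.reprK.
apply/ffunP => i; rewrite ffunE /= fc ?edge_backward // /c'.
case: pickP => [k /eqP /edge_inj ->|/(_ i)]; last by rewrite eqxx.
by rewrite generic_quotient.reprK.
Qed.

Lemma coords_ker (f : Pgroup n) : (f \in PId R n) = (coords f == 0).
Proof.
have Pf := valP f.
transitivity (val f \in Id R); first by [].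
rewrite -[0]/((0, 0) : W) xpair_eqE; apply/idP/andP => [If|[l_f /eqP m_f]].
  rewrite Zmod_pi_eq0 augmentation_Id //; split=> //.
  apply/eqP/ffunP => i; rewrite !ffunE; apply/eqP; rewrite Zmod_pi_eq0.
  by apply: crossing_Id => //; apply: edge_backward.
rewrite Zmod_pi_eq0 in l_f; apply: (Id_Pn n_gt0 Pf) => // e /edge_surj[i <-].
by rewrite -Zmod_pi_eq0; move/ffunP/(_ i): m_f; rewrite !ffunE => ->.
Qed.

Lemma Pquot_isomorphic : isomorphic (Pquot R n) W.
Proof. exact: (first_isomorphism coords_surj coords_ker). Qed.
End Quotient.

End Main.

Theorem theorem5 (R1 R2 : comPzRingType) (M : bimodType R1 R2) :
  let R := uptri M in
  let l := min_pos (fun n => (forall a : R1, a *+ n = 0) /\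
                             (forall b : R2, b *+ n = 0)) in
  let m := min_pos (fun n => forall v : M, v *+ n = 0) in
  let x := var 0 in let y := var 1 in let z := var 2 in let t := var 3 in
  let S := [:: (frcomm x y * frcomm z t)%F; x *+ l; frcomm x y *+ m] in
  [/\ {subset S <= Id R},
      (forall n : nat, (0 < n)%N ->
         forall f, f \in Pn n -> f \in Id R -> consequence S f)
    & (forall n : nat, (0 < n)%N ->
         isomorphic (Pquot R n) (Zmod l * {ffun 'I_(mrank n) -> Zmod m})%type)].
Proof.
split; first exact: identities_Id.
- by move=> n n_gt0 f; apply: Pn_Id_consequence.
- exact: Pquot_isomorphic.
Qed.
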